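(* Let $(U(n))_{n\ge 1}$ be independent random variables with $U(n)$ uniformly distributed on $\{1,\dots,n\}$, and let $(T_n)_{n\ge1}$ be defined by $T_1=0$ and $T_{n+1}=1+T_{U(n)}$ for $n\ge 1$. Let $m_n=\mathrm{E}\,T_n$ and $v_n=\mathrm{Var}\,T_n$. Then for each fixed $x\in\mathbb{R}$, as $n\to\infty$, $$\Pr\left(\frac{T_n-m_n}{v_n^{1/2}}\le x\right)\to\Phi(x),$$ where $\Phi$ is the standard normal distribution function.
   Context: The process $(T_n)$ is called the (uniformly) reverting clock. The statement is asymptotic, so only $n$ large enough that $v_n>0$ are concerned. *)

(* Defs.v *)
From mathcomp Require Export all_boot all_order all_algebra finmap.
From mathcomp Require Export all_classical all_reals all_analysis.
Export Order.TTheory GRing.Theory Num.Theory numFieldNormedType.Exports.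
Set Implicit Arguments.
Unset Strict Implicit.
Unset Printing Implicit Defensive.
Local Open Scope classical_set_scope.
Local Open Scope ring_scope.

(* Mutual independence of the family (X i) for i in D: the product rule holds
   for every finite set of indices J in D. *)
Definition mutually_independent d d' (Omega : measurableType d)
    (T : measurableType d') (R : realType) (P : probability Omega R)
    (I : choiceType) (D : set I) (X : I -> {RV P >-> T}) : Prop :=
  forall (J : {fset I}) (A : I -> set T),
    [set` J] `<=` D ->
    (forall i, i \in J -> measurable (A i)) ->
    P (\bigcap_(i in [set` J]) (X i @^-1` A i)) =
    (\prod_(i <- J) P (X i @^-1` A i))%E.

(* Uniform law on {1, ..., n}; meaningful for n >= 1 only (no X satisfies it
   when n = 0). X may still leave {1, ..., n} on a null event. *)
Definition uniform_upto d (Omega : measurableType d) (R : realType)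
    (P : probability Omega R) (n : nat) (X : {RV P >-> nat}) : Prop :=
  forall k : nat,
    P (X @^-1` [set k]) = (if (1 <= k <= n)%N then (n%:R^-1)%:E else 0)%E.

(* Since U n is in {1, ..., n} only almost surely, the recursion is required
   almost surely. The entries U 0 and T 0 are not constrained. *)
Definition reverting_clock d (Omega : measurableType d) (R : realType)
    (P : probability Omega R) (U T : nat -> {RV P >-> nat}) : Prop :=
  {ae P, forall w, T 1%N w = 0%N} /\
  forall n : nat, (1 <= n)%N ->
    {ae P, forall w, T n.+1 w = (1 + T (U n w) w)%N}.

(* The distribution function of N(0, 1), with values in \bar R. *)
Definition std_normal_cdf (R : realType) (x : R) : \bar R :=
  normal_prob 0 1 `]-oo, x].

(* Main.v *)
Require Import Defs.
From HB Require Import structures.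
From mathcomp Require Import ring lra measurable_realfun.
Set Implicit Arguments.
Unset Strict Implicit.
Unset Printing Implicit Defensive.
Local Open Scope classical_set_scope.
Local Open Scope ring_scope.

(** The proof identifies the law of the clock with that of a sum of
    independent Bernoulli variables, then proves a central limit theorem for
    such sums by Stein's method.

    The law.  T_k is almost surely a function of U(1), ..., U(k-1), hence
    independent of U(n) for k <= n ([clock_indep]).  Splitting on the value of
    U(n), the law of T_(n+1) is the average of the laws of 1 + T_1, ...,
    1 + T_n ([clock_average]).  Subtracting n times this identity from n+1
    times the one for n+1 leaves
      law T_(n+2) = (1 - 1/(n+1)) law T_(n+1) + 1/(n+1) law (1 + T_(n+1)),
    so that T_(n+1) is distributed as a sum of n independent Bernoulli
    variables of parameters 1, 1/2, ..., 1/n ([clock_law]).  Its variance is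
    at least (H_n - 1) / 2, with H_n the harmonic sum, and tends to infinity.

    The limit.  Let S be a sum of n independent Bernoulli variables, with mean
    m and variance s^2.  Adding the variables one at a time gives
      E[(S - m) F(S)] = s^2 E[F(S+1) - F(S)]
    up to s^2 times a bound on the second differences of F
    ([bernoulli_sum_stein]).  For W = (S - m) / s and F(S) = f(W) with f' an
    L-Lipschitz function, this says that E[f'(W) - W f(W)] is O(L / s).  If g
    is a ramp that goes from 1 to 0 between a and b, and c is its Gaussian
    mean, then Stein's equation f' - x f = g - c has the explicit solution
    [stein_solution]; its derivative is Lipschitz because f is a multiple of
    Mills' ratio away from [a, b], which the classical bounds on the Gaussian
    tail control ([std_normal_mills_bound]).  Hence E g(W) tends to c.  A ramp
    on [x, x + d] and a ramp on [x - d, x] bracket the indicator function of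
    ]-oo, x], and their Gaussian means lie between the values at x - d and at
    x + d of the normal distribution function, which is continuous. *)

(** * Sums of independent Bernoulli variables *)

Section bernoulli_sums.
Context {R : realType}.
Implicit Types (p : nat -> R) (g h F : nat -> R) (n : nat).

(** The mean of g(S), for S a sum of n independent Bernoulli variables of
    parameters p 0, ..., p (n-1), computed by conditioning on the last one.
    Working with this functional spares the construction of the variables. *)
Fixpoint bernoulli_sum_mean p n g : R :=
  if n is n'.+1 then
    (1 - p n') * bernoulli_sum_mean p n' g +
    p n' * bernoulli_sum_mean p n' (g \o S)
  else g 0%N.

Lemma eq_bernoulli_sum_mean p n g h : g =1 h ->
  bernoulli_sum_mean p n g = bernoulli_sum_mean p n h.
Proof. by move=> /funext ->. Qed.

Lemma bernoulli_sum_mean_linear p n a b g h :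
  bernoulli_sum_mean p n (fun k => a * g k + b * h k) =
  a * bernoulli_sum_mean p n g + b * bernoulli_sum_mean p n h.
Proof.
elim: n g h => [//|n IH] g h /=.
rewrite IH (_ : _ \o S = fun k => a * (g \o S) k + b * (h \o S) k)// IH.
ring.
Qed.

Lemma bernoulli_sum_mean_cst p n c : bernoulli_sum_mean p n (fun=> c) = c.
Proof.
elim: n => [//|n IH] /=.
by rewrite (_ : _ \o S = fun=> c)// IH -mulrDl subrK mul1r.
Qed.

Lemma bernoulli_sum_mean_affine p n a c g :
  bernoulli_sum_mean p n (fun k => a * g k + c) =
  a * bernoulli_sum_mean p n g + c.
Proof.
rewrite -[c in RHS]mulr1 -[1](bernoulli_sum_mean_cst p n).
rewrite -bernoulli_sum_mean_linear.
by apply: eq_bernoulli_sum_mean => k; rewrite mulr1.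
Qed.

Lemma bernoulli_sum_mean_sum p n m (c : 'I_m -> R) (g : 'I_m -> nat -> R) :
  bernoulli_sum_mean p n (fun k => \sum_(i < m) c i * g i k) =
  \sum_(i < m) c i * bernoulli_sum_mean p n (g i).
Proof.
elim: m c g => [|m IH] c g.
  rewrite big_ord0 -[RHS](bernoulli_sum_mean_cst p n).
  by apply: eq_bernoulli_sum_mean => k; rewrite big_ord0.
rewrite big_ord_recr/= -IH -[X in X + _]mul1r -bernoulli_sum_mean_linear.
by apply: eq_bernoulli_sum_mean => k; rewrite big_ord_recr/= mul1r.
Qed.

(** A sum of n Bernoulli variables is supported in {0, ..., n}. *)
Lemma eq_bernoulli_sum_mean_le p n g h :
  (forall k, (k <= n)%N -> g k = h k) ->
  bernoulli_sum_mean p n g = bernoulli_sum_mean p n h.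
Proof.
elim: n g h => [|n IH] g h gh /=; first exact: gh.
by rewrite (IH g h) ?(IH (g \o S) (h \o S))// => k kn; apply: gh => //; exact: leqW.
Qed.

Section unit_parameters.
Variables (p : nat -> R) (p01 : forall n, 0 <= p n <= 1).

Lemma le_bernoulli_sum_mean n g h : (forall k, g k <= h k) ->
  bernoulli_sum_mean p n g <= bernoulli_sum_mean p n h.
Proof.
elim: n g h => [|n IH] g h gh /=; first exact: gh.
have /andP[p0 p1] := p01 n.
by rewrite lerD// ler_wpM2l ?subr_ge0// IH// => k; exact: gh.
Qed.

Lemma norm_bernoulli_sum_mean_le n g B : (forall k, `|g k| <= B) ->
  `|bernoulli_sum_mean p n g| <= B.
Proof.
move=> gB; rewrite ler_norml -(bernoulli_sum_mean_cst p n B).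
rewrite -(bernoulli_sum_mean_cst p n (- _)) !le_bernoulli_sum_mean//.
- by move=> k; rewrite (le_trans _ (gB k))// ler_norm.
- move=> k; rewrite bernoulli_sum_mean_cst.
  by move: (gB k); rewrite ler_norml => /andP[].
Qed.

Definition bernoulli_variance n : R := \sum_(i < n) p i * (1 - p i).

(** The discrete Stein identity, by induction on n for all F at once.  If Z is
    a new Bernoulli variable of parameter q and G(k) is the mean of F(k + Z),
    then E[(S + Z - m - q) F(S + Z)] is E[(S - m) G(S)] plus
    q (1 - q) E[F(S + 1) - F(S)].  The induction hypothesis handles the first
    term; in the second one, replacing S by S + Z costs q times a mean of
    second differences. *)
Lemma bernoulli_sum_stein n F B :
  (forall k, `|F k.+2 - F k.+1 *+ 2 + F k| <= B) ->
  `|bernoulli_sum_mean p n (fun k => (k%:R - \sum_(i < n) p i) * F k)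
    - bernoulli_variance n * bernoulli_sum_mean p n (fun k => F k.+1 - F k)|
  <= bernoulli_variance n * B.
Proof.
elim: n F => [|n IH] F FB /=.
  by rewrite /bernoulli_variance !big_ord0 subrr !mul0r subrr normr0.
set m := \sum_(i < n) p i in IH *.
have /andP[p0 p1] := p01 n.
rewrite /bernoulli_variance !big_ord_recr/= -/(bernoulli_variance n) -/m.
set q := p n in p0 p1 *; set v := bernoulli_variance n in IH *.
pose G k := (1 - q) * F k + q * F k.+1.
have GB k : `|G k.+2 - G k.+1 *+ 2 + G k| <= B.
  rewrite (_ : _ + _ = (1 - q) * (F k.+2 - F k.+1 *+ 2 + F k) +
    q * (F k.+3 - F k.+2 *+ 2 + F k.+1)); last by rewrite /G; ring.
  rewrite (le_trans (ler_normD _ _))// !normrM (ger0_norm p0).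
  rewrite ger0_norm ?subr_ge0// (_ : B = (1 - q) * B + q * B); last by ring.
  by rewrite lerD// ler_wpM2l ?subr_ge0.
have := IH G GB.
pose D2 k := F k.+2 - F k.+1 *+ 2 + F k.
have D2B : `|bernoulli_sum_mean p n D2| <= B by exact: norm_bernoulli_sum_mean_le.
rewrite (_ : (1 - q) * _ + _ =
  bernoulli_sum_mean p n (fun k => (k%:R - m) * G k) +
  q * (1 - q) * bernoulli_sum_mean p n (fun k => F k.+1 - F k)); last first.
  rewrite -bernoulli_sum_mean_linear -[X in _ = X + _]mul1r -bernoulli_sum_mean_linear.
  by apply: eq_bernoulli_sum_mean => k; rewrite /G/= -natr1; ring.
rewrite (_ : (v + _) * _ = v * bernoulli_sum_mean p n (fun k => G k.+1 - G k) +
  q * (1 - q) * (bernoulli_sum_mean p n (fun k => F k.+1 - F k) +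
     q * bernoulli_sum_mean p n D2)); last first.
  rewrite mulrDl; congr (_ * _ + _ * _).
    rewrite -bernoulli_sum_mean_linear.
    by apply: eq_bernoulli_sum_mean => k; rewrite /G/=; ring.
  rewrite -bernoulli_sum_mean_linear -[X in _ = X + _]mul1r -bernoulli_sum_mean_linear.
  by apply: eq_bernoulli_sum_mean => k; rewrite /D2/=; ring.
set e1 := bernoulli_sum_mean p n (fun k => _ * G k).
set e2 := bernoulli_sum_mean p n (fun k => G _ - _) => steinG.
set e3 := bernoulli_sum_mean p n (fun k => F _ - _).
rewrite (_ : _ - _ = e1 - v * e2 - q * (1 - q) * (q * bernoulli_sum_mean p n D2));
  last by ring.
rewrite (le_trans (ler_normB _ _))// mulrDl lerD//.
rewrite !normrM (ger0_norm p0) ger0_norm ?subr_ge0//.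
rewrite ler_wpM2l// ?mulr_ge0 ?subr_ge0//.
by rewrite (le_trans _ D2B)// ler_piMl.
Qed.

(** [bernoulli_sum_stein] is exact when F has no second difference; here F = 1. *)
Lemma bernoulli_sum_mean_id n :
  bernoulli_sum_mean p n (fun k => k%:R) = \sum_(i < n) p i.
Proof.
have D2 k : `|cst 1 k.+2 - cst 1 k.+1 *+ 2 + cst 1 k| <= 0 :> R.
  by rewrite (_ : _ + _ = 0) ?normr0//=; ring.
have := bernoulli_sum_stein n D2; rewrite mulr0.
under eq_bernoulli_sum_mean do rewrite /= mulr1 -[_%:R]mul1r.
under [X in _ * X]eq_bernoulli_sum_mean do rewrite /= subrr.
rewrite bernoulli_sum_mean_affine bernoulli_sum_mean_cst mulr0 subr0 mul1r.
by rewrite normr_le0 subr_eq0 => /eqP.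
Qed.

(** The exact case F(k) = k - m of [bernoulli_sum_stein]. *)
Lemma bernoulli_sum_mean_var n :
  bernoulli_sum_mean p n (fun k => (k%:R - \sum_(i < n) p i) ^+ 2) =
  bernoulli_variance n.
Proof.
pose F k : R := k%:R - \sum_(i < n) p i.
have D2 k : `|F k.+2 - F k.+1 *+ 2 + F k| <= 0.
  by rewrite (_ : _ + F k = 0) ?normr0// /F -!natr1; ring.
have := bernoulli_sum_stein n D2; rewrite mulr0.
rewrite (_ : (fun k => F k.+1 - F k) = cst 1); last first.
  by apply/funext => k; rewrite /F -natr1/=; ring.
by rewrite bernoulli_sum_mean_cst mulr1 normr_le0 subr_eq0 => /eqP.
Qed.

End unit_parameters.
End bernoulli_sums.

(** * Calculus on the real line *)

Section calculus.
Context {R : realType}.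
Implicit Types f df : R -> R.

Lemma is_derive_continuous f df : (forall x : R, is_derive x 1 f (df x)) ->
  continuous f.
Proof.
move=> fdf x; apply/differentiable_continuous/derivable1_diffP.
by have [] := fdf x.
Qed.

Lemma is_derive_mean_value f df x y : (forall z : R, is_derive z 1 f (df z)) ->
  x <= y -> exists2 c, x <= c <= y & f y - f x = df c * (y - x).
Proof.
move=> fdf xy; have [//|c cxy fE] := MVT_segment xy (fun z _ => fdf z).
  by apply: continuous_subspaceT; exact: is_derive_continuous fdf.
by exists c => //; move: cxy; rewrite in_itv.
Qed.

Lemma bounded_derivative_lipschitz f df L : (forall x : R, is_derive x 1 f (df x)) ->
  (forall x, `|df x| <= L) -> forall x y, `|f x - f y| <= L * `|x - y|.
Proof.
move=> fdf dfL x y; wlog xy : x y / x <= y => [H|].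
  by have [/H//|/ltW/H] := leP x y; rewrite distrC (distrC x).
have [c _ fE] := is_derive_mean_value fdf xy.
by rewrite distrC fE normrM (distrC x) ler_wpM2r.
Qed.

(** Comparison from -oo: this is how both Gaussian tail bounds are obtained,
    without writing the tail as an integral. *)
Lemma ge0_derivative_vanishingNy f df u :
  (forall x : R, x <= u -> is_derive x 1 f (df x)) ->
  (forall x, x <= u -> 0 <= df x) ->
  f x @[x --> -oo] --> 0 -> 0 <= f u.
Proof.
move=> fdf df0 f0.
apply: (cvgr_to_le f0); near=> x.
have xu : x <= u by near: x; apply: nbhs_ninfty_le; rewrite num_real.
apply: (@ger0_derive1_ndecrNy _ f u) => //.
- by move=> z; rewrite in_itv/= => /ltW/fdf[].
- move=> z; rewrite in_itv/= => /ltW zu; have := fdf z zu => fz.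
  by rewrite derive1E derive_val df0.
- apply: derivable_within_continuous => z; rewrite in_itv/= => /fdf fz.
  exact: ex_derive.
Unshelve. all: by end_near. Qed.

Lemma cvgNy_le_inv f C : (forall x, x < 0 -> `|f x| <= C / - x) ->
  f x @[x --> -oo] --> 0.
Proof.
move=> fC; apply/cvgr0Pnorm_le => e e0; near=> x.
have x0 : x < 0 by near: x; apply: nbhs_ninfty_lt; rewrite num_real.
rewrite (le_trans (fC x x0))// ler_pdivrMr ?oppr_gt0//.
rewrite -ler_pdivrMl// lerNr.
by near: x; apply: nbhs_ninfty_le; rewrite num_real.
Unshelve. all: by end_near. Qed.

Lemma lipschitz_continuous (g : R -> R) K :
  (forall x y, `|g x - g y| <= K * `|x - y|) -> continuous g.
Proof.
move=> gK; have K0 : 0 <= K.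
  by have := gK 1 0; rewrite subr0 normr1 mulr1; exact: le_trans.
have K1 : 0 < K + 1 by rewrite ltr_wpDl.
move=> x; apply/cvgrPdist_le => e e0; near=> y.
rewrite (le_trans (gK x y))//.
rewrite (@le_trans _ _ ((K + 1) * `|x - y|))// ?ler_wpM2r ?lerDl//.
rewrite -ler_pdivlMl//; near: y.
by apply: cvgr_dist_le; [exact: cvg_id|rewrite mulr_gt0 ?invr_gt0].
Unshelve. all: by end_near. Qed.

End calculus.

(** * Gaussian masses of half-lines *)

Section gaussian.
Context {R : realType}.
Local Notation phi := (@normal_pdf R 0 1).
Local Notation mu := (@lebesgue_measure R).
Implicit Types (g : R -> R) (x : R).

Lemma std_normal_pdf_gt0 x : 0 < phi x.
Proof. by rewrite normal_pdfE ?oner_neq0// mulr_gt0 ?normal_peak_gt0 ?expR_gt0. Qed.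

Lemma std_normal_pdfN x : phi (- x) = phi x.
Proof. by rewrite !normal_pdfE ?oner_neq0// /normal_fun !subr0 sqrrN. Qed.

Lemma is_derive_std_normal_pdf x : is_derive x 1 phi (- x * phi x).
Proof.
rewrite normal_pdfE ?oner_neq0// /normal_fun.
have -> : (fun y : R => normal_peak 1 * expR (- (y - 0) ^+ 2 / (1 ^+ 2 *+ 2))) =
    normal_peak 1 \*: (expR \o ((- 2^-1) \*: (@id R ^+ 2))).
  apply/funext => y /=; rewrite subr0 expr1n /GRing.scale/=.
  by congr (_ * expR _); rewrite fctE /=; field.
have h : is_derive x 1 ((- 2^-1 : R) \*: (@id R ^+ 2)) (- x).
  by apply: is_derive_eq; rewrite /GRing.scale/=; field.
have h2 := is_derive1_comp (is_derive_expR _) h.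
have h3 := is_deriveZ (normal_peak 1) h2.
apply: (is_derive_eq h3).
rewrite /GRing.scale/= /GRing.scale/= fctE.
rewrite mulrA mulrC; congr (_ * (_ * expR _)).
by rewrite subr0 expr1n; field.
Qed.

(** For g = 1 this is the normal distribution function, written Phi below; for
    a ramp g it is a part of the solution of Stein's equation. *)
Definition gaussian_mass g x : R := \int[mu]_(t in `]-oo, x]) (g t * phi t).

Local Notation Phi := (gaussian_mass (cst 1)).

Lemma std_normal_cdfE x : std_normal_cdf x = (Phi x)%:E.
Proof.
rewrite /gaussian_mass /Rintegral fineK.
  by apply: eq_integral => t _ /=; rewrite mul1r.
apply: integrable_fin_num => //.
rewrite (_ : (fun=> _) = fun t => (phi t)%:E); last first.
  by apply/funext => t; rewrite mul1r.
exact: integrableS (integrable_normal_pdf 0 1).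
Qed.

(* The standard normal law as the law of the identity, to use the limits at
   infinity of distribution functions. *)
Let idTR : measurableTypeR R -> R := idfun.

#[local] HB.instance Definition _ :=
  @isMeasurableFun.Build _ _ _ _ idTR (@measurable_id _ _ setT).

Lemma gaussian_mass1_cvgNy : Phi x @[x --> -oo] --> (0 : R).
Proof.
pose P : probability (measurableTypeR R) R := normal_prob (0 : R) 1.
pose X : {RV P >-> R} := idTR.
have := @cvg_cdfNy0 _ _ _ P X.
rewrite (_ : cdf X = fun x => (Phi x)%:E); last first.
  by apply/funext => x; rewrite -std_normal_cdfE.
exact: fine_cvg.
Qed.

Lemma gaussian_mass1_cvgy : Phi x @[x --> +oo] --> (1 : R).
Proof.
pose P : probability (measurableTypeR R) R := normal_prob (0 : R) 1.
pose X : {RV P >-> R} := idTR.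
have := @cvg_cdfy1 _ _ _ P X.
rewrite (_ : cdf X = fun x => (Phi x)%:E); last first.
  by apply/funext => x; rewrite -std_normal_cdfE.
exact: fine_cvg.
Qed.

Lemma gaussian_mass1_le1 x : Phi x <= 1.
Proof.
rewrite -lee_fin -std_normal_cdfE.
exact: (@probability_le1 _ _ _ (normal_prob 0 1)).
Qed.

Section unit_bounded.
Variables (g : R -> R) (gc : continuous g) (g01 : forall x, 0 <= g x <= 1).

Lemma gaussian_mass_integrable x :
  mu.-integrable `]-oo, x] (EFin \o (fun t => g t * phi t)).
Proof.
have phii : mu.-integrable `]-oo, x] (fun t => (phi t)%:E).
  exact: integrableS (integrable_normal_pdf 0 1).
apply: le_integrable phii => //.
- apply/measurable_EFinP/measurable_funM; apply: measurable_funTS.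
    exact: continuous_measurable_fun.
  exact: measurable_normal_pdf.
- move=> t _ /=; have /andP[g0 g1] := g01 t.
  by rewrite lee_fin normrM (ger0_norm g0) ler_piMl.
Qed.

Lemma is_derive_gaussian_mass x :
  is_derive x 1 (gaussian_mass g) (g x * phi x).
Proof.
have [|||D E] := @continuous_FTC1 R (fun t => g t * phi t) -oo%O x (x + 1) _
    (gaussian_mass_integrable (x + 1)).
- by rewrite ltrDl.
- by rewrite ltNyr.
- by apply: continuousM; [exact: gc|exact/continuous_normal_pdf/oner_neq0].
by split => //; rewrite -E derive1E.
Qed.

Lemma gaussian_mass_ge0 x : 0 <= gaussian_mass g x.
Proof.
apply: Rintegral_ge0 => t _; have /andP[? _] := g01 t.
by rewrite mulr_ge0// normal_pdf_ge0.
Qed.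

Lemma gaussian_mass_nondecreasing : {homo gaussian_mass g : x y / x <= y}.
Proof.
move=> x y xy.
have [c _ E] := is_derive_mean_value is_derive_gaussian_mass xy.
rewrite -subr_ge0 E; have /andP[? _] := g01 c.
by rewrite !mulr_ge0 ?subr_ge0// normal_pdf_ge0.
Qed.

End unit_bounded.

Let cst1_01 (x : R) : 0 <= (cst 1 x : R) <= 1. Proof. by rewrite ler01 lexx. Qed.

Lemma is_derive_Phi x : is_derive x 1 Phi (phi x).
Proof.
have c1 : continuous (cst 1 : R -> R) by move=> y; exact: cvg_cst.
by rewrite -[phi x]mul1r; exact: (is_derive_gaussian_mass c1 cst1_01).
Qed.

Lemma gaussian_mass_le g x : continuous g -> (forall x, 0 <= g x <= 1) ->
  gaussian_mass g x <= Phi x.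
Proof.
move=> gc g01; apply: le_Rintegral => //.
- exact: gaussian_mass_integrable.
- by apply: gaussian_mass_integrable; [move=> y; exact: cvg_cst|exact: cst1_01].
- move=> t _; rewrite ler_wpM2r ?normal_pdf_ge0//.
  by have /andP[] := g01 t.
Qed.

Lemma gaussian_mass_eq1 g a x : (forall t, t <= a -> g t = 1) -> x <= a ->
  gaussian_mass g x = Phi x.
Proof.
move=> g1 xa; apply: eq_Rintegral => t; rewrite inE/= in_itv/= => tx.
by rewrite g1// (le_trans tx).
Qed.

Lemma gaussian_mass_eq0 g b x : continuous g -> (forall x, 0 <= g x <= 1) ->
  (forall t, b <= t -> g t = 0) -> b <= x -> gaussian_mass g x = gaussian_mass g b.
Proof.
move=> gc g01 g0 bx.
have [c /andP[bc _] E] := is_derive_mean_value (is_derive_gaussian_mass gc g01) bx.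
by apply/eqP; rewrite -subr_eq0 E g0// !mul0r.
Qed.

End gaussian.

(** * Mills' ratio *)

(** The bounds only use that Q is a primitive of the normal density that
    vanishes at -oo: they serve for Phi and, on the right half-line, for
    y |-> 1 - Phi (- y). *)
Section mills.
Context {R : realType}.
Local Notation phi := (@normal_pdf R 0 1).
Variables (Q : R -> R) (Q' : forall x : R, is_derive x 1 Q (phi x)).
Hypothesis Q0 : Q x @[x --> -oo] --> (0 : R).

(** The difference of the two sides vanishes at -oo and has derivative phi / x^2. *)
Lemma std_normal_tail_le (x : R) : x < 0 -> Q x <= phi x / - x.
Proof.
move=> x0; rewrite -subr_ge0.
pose f : R -> R := phi * (fun y => (- y)^-1) - Q.
apply: (@ge0_derivative_vanishingNy _ f (fun y => phi y / y ^+ 2)) => [y yx|y _|].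
- have y0 : y < 0 by exact: le_lt_trans x0.
  have hV : is_derive y 1 (fun z : R => (- z)^-1) (- (- y) ^- 2 *: - 1).
    by apply: is_deriveV; rewrite oppr_eq0 lt_eqF.
  have := is_derive_std_normal_pdf y => hphi.
  apply: is_derive_eq.
  by rewrite /GRing.scale/=; field; rewrite lt_eqF.
- by rewrite divr_ge0 ?normal_pdf_ge0 ?sqr_ge0.
- rewrite -[X in _ --> X](subr0 0); apply: cvgB; last exact: Q0.
  apply: (@cvgNy_le_inv _ _ (normal_peak 1)) => y y0 /=.
  rewrite normrM ger0_norm ?normal_pdf_ge0// gtr0_norm ?invr_gt0 ?oppr_gt0//.
  by rewrite ler_pM2r ?invr_gt0 ?oppr_gt0// normal_pdf_ub ?oner_neq0.
Qed.

(** The difference of the two sides vanishes at -oo and has derivative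
    2 phi / (1 + x^2)^2. *)
Lemma std_normal_tail_ge (x : R) : - x * phi x / (1 + x ^+ 2) <= Q x.
Proof.
have sq_neq0 (y : R) : 1 + y ^+ 2 != 0 by rewrite gt_eqF// ltr_pwDl// sqr_ge0.
rewrite -subr_ge0.
pose f : R -> R := Q - (fun y => (- y * phi y) / (1 + y ^+ 2)).
apply: (@ge0_derivative_vanishingNy _ f
  (fun y => phi y * 2 / (1 + y ^+ 2) ^+ 2)) => [y yx|y _|].
- have hV : is_derive y 1 (fun z : R => (1 + z ^+ 2)^-1)
      (- (1 + y ^+ 2) ^- 2 *: (y *+ 2)).
    apply: (is_deriveV (f := cst 1 + (@id R) ^+ 2)); first exact: sq_neq0.
    by apply: is_derive_eq; rewrite /GRing.scale/=; ring.
  have := is_derive_std_normal_pdf y => hphi.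
  have hf : is_derive y 1 ((-%R * phi) * (fun z : R => (1 + z ^+ 2)^-1) : R -> R)
     (((- y * phi y) * (- (1 + y ^+ 2) ^- 2 * (y *+ 2)) + (1 + y ^+ 2)^-1 *
      (- y * (- y * phi y) + phi y * - 1))).
    by apply: is_derive_eq.
  apply: is_derive_eq.
  by field; exact: sq_neq0.
- by rewrite !mulr_ge0 ?normal_pdf_ge0// invr_ge0 sqr_ge0.
- rewrite -[X in _ --> X](subr0 0); apply: cvgB; first exact: Q0.
  apply: (@cvgNy_le_inv _ _ (normal_peak 1)) => y y0 /=.
  rewrite !normrM normfV (gtr0_norm (x := 1 + _)); last by rewrite ltr_pwDl// sqr_ge0.
  rewrite ler_pdivrMr; last by rewrite ltr_pwDl// sqr_ge0.
  have ny0 : 0 <= - y by rewrite oppr_ge0 ltW.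
  rewrite (ger0_norm ny0) (ger0_norm (normal_pdf_ge0 _ _ _)).
  rewrite [leRHS]mulrAC ler_pdivlMr ?oppr_gt0// (mulrC (- y)).
  rewrite -mulrA -expr2 sqrrN ler_pM//.
  + exact: normal_pdf_ge0.
  + exact: sqr_ge0.
  + by rewrite normal_pdf_ub ?oner_neq0.
  + by rewrite lerDr.
Qed.

(** The bounded quantity is the second derivative of Mills' ratio Q / phi, so
    this keeps the derivative of the solution of Stein's equation Lipschitz in
    the tails. *)
Lemma std_normal_mills_bound (x : R) : x <= -1 ->
  0 <= (1 + x ^+ 2) * (Q x / phi x) + x <= 1.
Proof.
move=> x1; have x0 : x < 0 by rewrite (le_lt_trans x1)// ltrN10.
have p0 := std_normal_pdf_gt0 x.
have s0 : 0 < 1 + x ^+ 2 by rewrite ltr_pwDl// sqr_ge0.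
apply/andP; split.
  have := std_normal_tail_ge x.
  rewrite ler_pdivrMr// => H.
  rewrite -lerBlDr sub0r mulrA ler_pdivlMr//.
  by rewrite (mulrC (1 + _)).
set q := Q x / phi x.
have xq : - x * q <= 1.
  rewrite mulrA ler_pdivrMr// mul1r mulrC -ler_pdivlMr ?oppr_gt0//.
  exact: std_normal_tail_le.
have q1 : q <= 1 by nra.
nra.
Qed.

End mills.

(** * Stein's equation *)

Section stein.
Context {R : realType}.
Local Notation phi := (@normal_pdf R 0 1).
Local Notation Phi := (@gaussian_mass R (cst 1)).

(** The variable g stands for a Lipschitz cutoff equal to 1 before a and to 0
    after b, so that its Gaussian mean is the mass c accumulated at b. *)
Section solution.
Variables (g : R -> R) (a b K : R).
Hypotheses (g01 : forall x, 0 <= g x <= 1)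
  (gK : forall x y, `|g x - g y| <= K * `|x - y|).
Hypotheses (ga : forall x, x <= a -> g x = 1) (gb : forall x, b <= x -> g x = 0).

Let c := gaussian_mass g b.

(** Obtained from f' - x f = g - c by the integrating factor phi. *)
Definition stein_solution x : R := (gaussian_mass g x - c * Phi x) / phi x.

Let gc : continuous g := lipschitz_continuous gK.

Let c01 : 0 <= c <= 1.
Proof.
apply/andP; split; first exact: gaussian_mass_ge0.
exact: le_trans (gaussian_mass_le _ gc g01) (gaussian_mass1_le1 _).
Qed.

Lemma is_derive_stein_solution (x : R) :
  is_derive x 1 stein_solution (x * stein_solution x + g x - c).
Proof.
have p0 : phi x != 0 by rewrite gt_eqF// std_normal_pdf_gt0.
have h1 := is_derive_gaussian_mass gc g01 x.
have h2 := is_derive_Phi x.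
have h3 := is_deriveV p0 (is_derive_std_normal_pdf x).
have h4 : is_derive x 1 ((gaussian_mass g - c *: Phi) * (fun y => (phi y)^-1))
  (x * stein_solution x + g x - c).
  apply: is_derive_eq; rewrite /stein_solution !fctE /GRing.scale/= /GRing.scale/=.
  by field.
exact: h4.
Qed.

(* The derivative of x f(x), where f is the solution; since f' = x f + g - c,
   a bound on D makes f' Lipschitz. *)
Let D x := stein_solution x + x * (x * stein_solution x + g x - c).

Let is_derive_mul_solution (x : R) :
  is_derive x 1 (fun y => y * stein_solution y) (D x).
Proof.
have h := is_derive_stein_solution x.
have h2 : is_derive x 1 (id * stein_solution : R -> R) (D x).
  by apply: is_derive_eq; rewrite /D /GRing.scale/=; ring.
exact: h2.
Qed.

(* Before a the solution is (1 - c) Phi / phi. *)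
Let D_left x : x <= a -> x <= -1 -> `|D x| <= 1.
Proof.
move=> xa x1.
have := std_normal_mills_bound is_derive_Phi gaussian_mass1_cvgNy x1.
set q := _ / _ => /andP[q0 q1].
have /andP[c0 c1] := c01.
rewrite (_ : D x = (1 - c) * ((1 + x ^+ 2) * q + x)); last first.
  rewrite /D /stein_solution (gaussian_mass_eq1 ga)// ga// /q.
  by field; rewrite gt_eqF// std_normal_pdf_gt0.
by rewrite ger0_norm ?mulr_ge0 ?subr_ge0// mulr_ile1 ?subr_ge0// gerBl.
Qed.

(* After b the solution is c (1 - Phi) / phi, the mirror image of the left tail. *)
Let D_right x : b <= x -> 1 <= x -> `|D x| <= 1.
Proof.
move=> bx x1.
pose Q (y : R) : R := 1 - Phi (- y).
have Q' (y : R) : is_derive y 1 Q (phi y).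
  have h1 := is_derive_Phi (- y).
  have h2 : is_derive y 1 (cst 1 - (Phi \o -%R) : R -> R) (phi y).
    by apply: is_derive_eq; rewrite std_normal_pdfN mulrN1 sub0r opprK.
  exact: h2.
have Q0 : Q y @[y --> -oo] --> (0 : R).
  rewrite -[X in _ --> X](subrr 1); apply: cvgB; first exact: cvg_cst.
  rewrite cvgNy_compNP /= (_ : (fun=> _) = Phi); first exact: gaussian_mass1_cvgy.
  by apply/funext => y /=; rewrite opprK.
have := @std_normal_mills_bound _ Q Q' Q0 (- x); rewrite lerN2 => /(_ x1).
rewrite std_normal_pdfN; set q := _ / _ => /andP[q0 q1].
have /andP[c0 c1] := c01.
rewrite (_ : D x = c * ((1 + (- x) ^+ 2) * q + - x)); last first.
  rewrite /D /stein_solution (gaussian_mass_eq0 gc g01 gb)// gb// /q /Q opprK -/c.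
  by field; rewrite gt_eqF// std_normal_pdf_gt0.
by rewrite ger0_norm ?mulr_ge0// mulr_ile1.
Qed.

Let continuous_D : continuous D.
Proof.
have fc := is_derive_continuous is_derive_stein_solution.
move=> x; apply: cvgD; first exact: fc.
apply: cvgM; first exact: cvg_id.
apply: cvgB; last exact: cvg_cst.
apply: cvgD; last exact: gc.
by apply: cvgM; [exact: cvg_id|exact: fc].
Qed.

Let D_bounded : exists C, forall x, `|D x| <= C.
Proof.
pose A := Num.min a (- 1); pose B := Num.max b 1.
have AB : A <= B.
  rewrite (@le_trans _ _ (-1)) ?ge_min ?lexx ?orbT//.
  by rewrite (@le_trans _ _ 1) ?le_max ?lexx ?orbT// lerN10.
have [|m _ mD] := @EVT_max R (fun x => `|D x|) A B AB.
  apply: continuous_subspaceT => x.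
  by apply: cvg_norm; exact: continuous_D.
exists (Num.max 1 `|D m|) => x; rewrite le_max.
have [xA|Ax] := leP x A.
  by move: xA; rewrite le_min => /andP[xa x1]; rewrite D_left.
have [Bx|xB] := leP B x.
  by move: Bx; rewrite ge_max => /andP[bx x1]; rewrite D_right.
by rewrite mD ?orbT// in_itv/= !ltW.
Qed.

Lemma stein_solution_lipschitz : exists L, forall x y,
  `|(x * stein_solution x + g x - c) - (y * stein_solution y + g y - c)| <=
  L * `|x - y|.
Proof.
have [C DC] := D_bounded.
exists (C + K) => x y.
have := bounded_derivative_lipschitz is_derive_mul_solution DC x y.
rewrite (_ : _ - _ - _ = (x * stein_solution x - y * stein_solution y) +
    (g x - g y)); last by ring.
by move=> H; rewrite (le_trans (ler_normD _ _))// mulrDl lerD.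
Qed.

End solution.

Definition ramp (a b t : R) : R := Num.max 0 (Num.min 1 ((b - t) / (b - a))).

Section ramp.
Variables (a b : R) (ab : a < b).

Lemma ramp01 t : 0 <= ramp a b t <= 1.
Proof. by rewrite /ramp le_max lexx/= ge_max ler01 ge_min lexx. Qed.

Lemma ramp_eq1 t : t <= a -> ramp a b t = 1.
Proof.
move=> ta; rewrite /ramp min_l ?max_r//.
by rewrite ler_pdivlMr ?subr_gt0// mul1r lerB.
Qed.

Lemma ramp_eq0 t : b <= t -> ramp a b t = 0.
Proof.
move=> bt; rewrite /ramp max_l// ge_min; apply/orP; right.
by rewrite pmulr_lle0 ?invr_gt0 ?subr_gt0// subr_le0.
Qed.

Lemma ramp_lipschitz x y : `|ramp a b x - ramp a b y| <= (b - a)^-1 * `|x - y|.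
Proof.
have k0 : 0 < (b - a)^-1 by rewrite invr_gt0 subr_gt0.
wlog xy : x y / x <= y => [H|].
  by have [/H//|/ltW/H] := leP x y; rewrite distrC (distrC x).
rewrite /ramp -[in leRHS]normrN opprB (ger0_norm (x := y - x)) ?subr_ge0//.
set k := (b - a)^-1 in k0 *.
have : k * x <= k * y by rewrite ler_pM2l.
rewrite !mulrBl mulrBr (mulrC x) (mulrC y).
move: (k * x) (k * y) (b * k) => u v w uv.
rewrite ler_norml /Num.max/= /Num.min/=.
by do !case: ifPn; rewrite -?leNgt => *; apply/andP; split; lra.
Qed.

Lemma ramp_continuous : continuous (ramp a b).
Proof. exact: lipschitz_continuous ramp_lipschitz. Qed.

End ramp.
End stein.

(** * Central limit theorem for Bernoulli sums *)

Section clt.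
Context {R : realType}.
Local Notation Phi := (@gaussian_mass R (cst 1)).
Variables (p : nat -> R) (p01 : forall n, 0 <= p n <= 1).

Definition standardized n (k : nat) : R :=
  (k%:R - \sum_(i < n) p i) / Num.sqrt (bernoulli_variance p n).

(** [bernoulli_sum_stein] for F(k) = f((k - m) / s).  By the mean value theorem
    s (F(k+1) - F(k)) is f' at a point c k within 1 / s of (k - m) / s; this
    bounds the second differences of F by 3 L / s^2 and gives the error L / s
    of the replacement of c k by (k - m) / s. *)
Lemma bernoulli_sum_stein_bound (f df : R -> R) (L : R) n :
  (forall x : R, is_derive x 1 f (df x)) ->
  (forall x y, `|df x - df y| <= L * `|x - y|) ->
  0 < bernoulli_variance p n ->
  `|bernoulli_sum_mean p n (fun k =>
      df (standardized n k) - standardized n k * f (standardized n k))|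
  <= 4 * L / Num.sqrt (bernoulli_variance p n).
Proof.
move=> fdf dfL v0; rewrite /standardized.
set v := bernoulli_variance p n in v0 *; set m := \sum_(i < n) p i.
set s := Num.sqrt v; have s0 : 0 < s by rewrite sqrtr_gt0.
have vE : v = s ^+ 2 by rewrite sqr_sqrtr// ltW.
have L0 : 0 <= L.
  by have := dfL 1 0; rewrite subr0 normr1 mulr1; exact: le_trans.
pose W k := (k%:R - m) / s.
have WS k : W k.+1 = W k + s^-1 by rewrite /W -natr1; field; rewrite gt_eqF.
have /all_sig2[c cW fc] : forall k, {c | `|c - W k| <= s^-1 &
    f (W k.+1) - f (W k) = df c * s^-1}.
  move=> k; apply/cid2; have WW : W k <= W k.+1.
    by rewrite WS lerDl invr_ge0 ltW.
  have [c /andP[kc ck] E] := is_derive_mean_value fdf WW.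
  exists c; last by rewrite E WS addrAC subrr add0r.
  by rewrite ger0_norm ?subr_ge0// lerBlDl -WS.
pose F k := f (W k).
have D2F k : `|F k.+2 - F k.+1 *+ 2 + F k| <= 3 * L / v.
  rewrite (_ : _ + _ = (F k.+2 - F k.+1) - (F k.+1 - F k)); last by ring.
  rewrite /F !fc -mulrBl normrM (gtr0_norm (x := s^-1)) ?invr_gt0// vE invfM mulrA.
  rewrite ler_pM2r ?invr_gt0//.
  rewrite (le_trans (dfL _ _))// (mulrC 3) -mulrA ler_wpM2l//.
  rewrite (_ : _ - _ = (c k.+1 - W k.+1) + (s^-1 - (c k - W k)));
    last by rewrite WS; ring.
  rewrite (le_trans (ler_normD _ _))//.
  have := ler_normB s^-1 (c k - W k); rewrite (gtr0_norm (x := s^-1)) ?invr_gt0//.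
  by have := cW k; have := cW k.+1; lra.
have := bernoulli_sum_stein p01 n D2F; rewrite -/v -/m.
rewrite [_ * (_ / v)]mulrC divfK ?gt_eqF// => stein.
have dfc : `|bernoulli_sum_mean p n (fun k => df (W k) - df (c k))| <= L / s.
  apply: norm_bernoulli_sum_mean_le => // k.
  by rewrite (le_trans (dfL _ _))// ler_wpM2l// distrC.
rewrite (_ : bernoulli_sum_mean _ _ _ = - s^-1 *
    (bernoulli_sum_mean p n (fun k => (k%:R - m) * F k) -
     v * bernoulli_sum_mean p n (fun k => F k.+1 - F k)) +
    bernoulli_sum_mean p n (fun k => df (W k) - df (c k))); last first.
  rewrite [X in _ * (X - _)](_ : _ = 1 * bernoulli_sum_mean p n
    (fun k => (k%:R - m) * F k)) ?mul1r// -mulNr.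
  rewrite -{1}[bernoulli_sum_mean _ _ _ in RHS]mul1r.
  rewrite -!bernoulli_sum_mean_linear -[X in _ + X]mul1r -bernoulli_sum_mean_linear.
  apply: eq_bernoulli_sum_mean => k; rewrite /F fc vE /W.
  by field; rewrite gt_eqF.
rewrite (le_trans (ler_normD _ _))// (_ : 4 * L / s = s^-1 * (3 * L) + L / s);
  last by ring.
have si0 : 0 < s^-1 by rewrite invr_gt0.
by rewrite lerD// mulNr normrN normrM (gtr0_norm si0) ler_pM2l.
Qed.

(** Stein's equation turns [bernoulli_sum_stein_bound] into a statement about ramps. *)
Lemma bernoulli_sum_ramp (a b : R) : a < b -> exists L, forall n,
  0 < bernoulli_variance p n ->
  `|bernoulli_sum_mean p n (fun k => ramp a b (standardized n k)) -
    gaussian_mass (ramp a b) b| <= L / Num.sqrt (bernoulli_variance p n).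
Proof.
move=> ab; set g := ramp a b; set c := gaussian_mass g b.
have [L fL] := stein_solution_lipschitz (ramp01 a b) (ramp_lipschitz ab)
  (ramp_eq1 ab) (ramp_eq0 ab).
have fdf := is_derive_stein_solution b (ramp01 a b) (ramp_lipschitz ab).
exists (4 * L) => n v0.
have := bernoulli_sum_stein_bound fdf fL v0.
rewrite (_ : (fun k => _) = (fun k => 1 * g (standardized n k) + - c)).
  by rewrite bernoulli_sum_mean_affine mul1r.
by apply/funext => k; rewrite -/g -/c; ring.
Qed.

(** The indicator function of ]-oo, x] lies between the ramps on [y, x] and on
    [x, z], for y < x < z chosen by continuity of Phi. *)
Theorem bernoulli_sum_clt (x : R) :
  bernoulli_variance p n @[n --> \oo] --> +oo ->
  bernoulli_sum_mean p n (fun k => (standardized n k <= x)%R%:R) @[n --> \oo] -->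
  Phi x.
Proof.
move=> vy; apply/cvgrPdist_le => e e0.
have e20 : 0 < e / 2 by rewrite divr_gt0.
have Phic : continuous Phi := is_derive_continuous is_derive_Phi.
have /cvgrPdist_le/(_ _ e20)/nbhs_ballP[d /= d0 Phid] := Phic x.
have Phidist y : `|x - y| < d -> `|Phi x - Phi y| <= e / 2 by exact: Phid.
have d20 : 0 < d / 2 by rewrite divr_gt0.
have dd : d / 2 < d by rewrite ltr_pdivrMr// ltr_pMr// ltr1n.
pose y := x - d / 2; pose z := x + d / 2.
have yx : y < x by rewrite ltrBlDr ltrDl.
have xz : x < z by rewrite ltrDl.
have [L1 HL1] := bernoulli_sum_ramp yx.
have [L2 HL2] := bernoulli_sum_ramp xz.
have small L : \forall n \near \oo, 0 < bernoulli_variance p n /\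
    L / Num.sqrt (bernoulli_variance p n) <= e / 2.
  near=> n.
  have v0 : 0 < bernoulli_variance p n.
    by near: n; move/cvgryPgt : vy; apply.
  split=> //; rewrite ler_pdivrMr ?sqrtr_gt0// -ler_pdivrMl//.
  rewrite (le_trans (ler_norm _))// -sqrtr_sqr (ler_sqrt _ (ltW v0)).
  by near: n; move/cvgryPge : vy; apply.
near=> n.
have [v0 small1] : 0 < bernoulli_variance p n /\
    L1 / Num.sqrt (bernoulli_variance p n) <= e / 2 by near: n; exact: small.
have [_ small2] : 0 < bernoulli_variance p n /\
    L2 / Num.sqrt (bernoulli_variance p n) <= e / 2 by near: n; exact: small.
have := HL1 n v0; have := HL2 n v0.
set Ez := bernoulli_sum_mean _ _ _; set Ey := bernoulli_sum_mean _ _ _.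
set cz := gaussian_mass _ z; set cy := gaussian_mass _ x => HEz HEy.
set F := bernoulli_sum_mean _ _ _.
have FEz : F <= Ez.
  apply: le_bernoulli_sum_mean => // k; have [Wx|xW] := leP _ x.
    by rewrite ramp_eq1.
  by have /andP[] := ramp01 x z (standardized n k).
have EyF : Ey <= F.
  apply: le_bernoulli_sum_mean => // k; have [Wx|xW] := leP _ x.
    by have /andP[] := ramp01 y x (standardized n k).
  by rewrite ramp_eq0// ltW.
have czle : cz <= Phi z.
  by apply: gaussian_mass_le; [exact: ramp_continuous|exact: ramp01].
have cyge : Phi y <= cy.
  rewrite -(gaussian_mass_eq1 (ramp_eq1 yx) (lexx y)).
  apply: gaussian_mass_nondecreasing; last exact: ltW.
    exact: ramp_continuous.
  exact: ramp01.
have Phiz : `|Phi x - Phi z| <= e / 2.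
  by apply: Phidist; rewrite /z opprD addrA subrr add0r normrN gtr0_norm.
have Phiy : `|Phi x - Phi y| <= e / 2.
  by apply: Phidist; rewrite /y opprB addrC subrK gtr0_norm.
move: HEz HEy Phiz Phiy; rewrite !ler_norml.
lra.
Unshelve. all: by end_near. Qed.

End clt.

(** * Law of the reverting clock *)

Lemma measure_ae_eq d (Omega : measurableType d) (R : realType)
    (P : {measure set Omega -> \bar R}) (A B : set Omega) :
  measurable A -> measurable B -> {ae P, forall w, A w <-> B w} -> P A = P B.
Proof.
move=> mA mB AB.
rewrite -(setIT A) -(setIT B) -!integral_indic//.
apply: ae_eq_integral => //; try exact/measurable_EFinP/measurable_indic.
apply: filterS AB => w ABw _ /=; congr (_%:E).
by rewrite !indicE; congr ((nat_of_bool _)%:R); apply/idP/idP; rewrite !inE => /ABw.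
Qed.

Section clock.
Context (R : realType) (d : measure_display) (Omega : measurableType d)
  (P : probability Omega R) (U T : nat -> {RV P >-> nat}).
Hypotheses (U_indep : mutually_independent [set n : nat | (1 <= n)%N] U)
    (U_unif : forall n : nat, (1 <= n)%N -> uniform_upto n (U n))
    (T_clock : reverting_clock U T).

Let measurable_preim (X : {RV P >-> nat}) (A : set nat) : measurable (X @^-1` A).
Proof. by rewrite -[_ @^-1` _]setTI; exact: (measurable_funP X). Qed.

Let measurable_Ucyl (J : {fset nat}) (B : nat -> set nat) :
  measurable (\bigcap_(i in [set` J]) (U i @^-1` B i)).
Proof. by apply: fin_bigcap_measurable => // i _; exact: measurable_preim. Qed.

(** The values outside {1, ..., n} form a countable union of null events. *)
Lemma uniform_upto_ae n : (1 <= n)%N -> {ae P, forall w, (1 <= U n w <= n)%N}.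
Proof.
move=> n1; have : P.-negligible (\bigcup_k
    (if (1 <= k <= n)%N then set0 else U n @^-1` [set k])).
  apply: negligible_bigcup => k; case: ifPn => kn; first exact: negligible_set0.
  exists (U n @^-1` [set k]); split=> //.
  by have := U_unif n1 k; rewrite (negbTE kn).
apply: negligibleS => w /= Uw; exists (U n w) => //.
by rewrite ifF//; exact/negbTE/negP.
Qed.

(** The event T_(n+1) in A splits, up to a null set, according to U(n). *)
Lemma clock_decomposition n (A : set nat) (D : set Omega) :
  (1 <= n)%N -> measurable D ->
  P (T n.+1 @^-1` A `&` D) =
  (\sum_(k < n) P (T k.+1 @^-1` (S @^-1` A) `&` (U n @^-1` [set k.+1] `&` D)))%E.
Proof.
move=> n1 mD.
pose F (k : nat) := T k.+1 @^-1` (S @^-1` A) `&` (U n @^-1` [set k.+1] `&` D).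
have mF k : measurable (F k).
  by apply: measurableI => //; exact: measurableI.
have mUF : measurable (\big[setU/set0]_(k < n) F k).
  exact: bigsetU_measurable.
rewrite -(measure_semi_additive_ord_I P (F := F))//; last first.
  apply/trivIsetP => i j _ _ ij; rewrite -subset0 => w [[_ [/= Ui _]] [_ [/= Uj _]]].
  by move/negP : ij; apply; apply/eqP/succn_inj; rewrite -Ui -Uj.
apply: measure_ae_eq.
- exact: measurableI.
- by [].
have [_ /(_ n n1) Tn] := T_clock.
rewrite -bigcup_mkord; apply: filterS2 (uniform_upto_ae n1) Tn => w
  /andP[U1 Un] Tn; split.
  move=> [/= TA Dw].
  have Un' : ((U n w).-1 < n)%N by rewrite prednK.
  exists (U n w).-1 => //; split => /=; rewrite prednK//.
  by rewrite Tn in TA.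
by move=> [k _ [/= TA [/= Uk Dw]]]; split => //=; rewrite Tn Uk.
Qed.

(** The induction carries an arbitrary finite set J of later indices, because
    on the event U(n) = k the variable T_(n+1) is 1 + T_k, and U(n) then joins
    the family of which T_k is independent. *)
Lemma clock_indep n (A : set nat) (J : {fset nat}) (B : nat -> set nat) :
  (1 <= n)%N -> (forall i, i \in J -> (n <= i)%N) ->
  P (T n @^-1` A `&` \bigcap_(i in [set` J]) (U i @^-1` B i)) =
  (P (T n @^-1` A) * P (\bigcap_(i in [set` J]) (U i @^-1` B i)))%E.
Proof.
elim/ltn_ind: n A J B => -[//|[|n]] IH A J B _ nJ.
  have [T1 _] := T_clock.
  set D := \bigcap_(i in _) _; have mD : measurable D by exact: measurable_Ucyl.
  have mTA := measurable_preim (T 1) A.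
  have [A0|A0] := pselect (A 0%N).
    have -> : P (T 1 @^-1` A) = P setT.
      by apply: measure_ae_eq => //; apply: filterS T1 => w /= ->.
    have -> : P (T 1 @^-1` A `&` D) = P D.
      apply: measure_ae_eq => //; first exact: measurableI.
      by apply: filterS T1 => w T1w; split => [[]//|Dw]; split=> //=; rewrite T1w.
    by rewrite probability_setT mul1e.
  have -> : P (T 1 @^-1` A) = P set0.
    by apply: measure_ae_eq => //; apply: filterS T1 => w /= ->.
  have -> : P (T 1 @^-1` A `&` D) = P set0.
    apply: measure_ae_eq => //; first exact: measurableI.
    by apply: filterS T1 => w T1w; split => // -[/=]; rewrite T1w.
  by rewrite measure0 mul0e.
(* Both sides are decomposed, with the cylinder event on the left and the sure
   event on the right; the sums agree term by term. *)
rewrite clock_decomposition// -[T n.+2 @^-1` A]setIT clock_decomposition//.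
rewrite ge0_sume_distrl//; apply: eq_bigr => k _; rewrite setIT.
have nJ' : n.+1 \notin J by apply/negP => /nJ; rewrite ltnn.
pose B' i := if i == n.+1 then [set k.+1] else B i.
have J'E : U n.+1 @^-1` [set k.+1] `&` \bigcap_(i in [set` J]) (U i @^-1` B i) =
    \bigcap_(i in [set` (n.+1 |` J)%fset]) (U i @^-1` B' i).
  rewrite set_fsetU1 bigcap_setU1 /B' eqxx; congr (_ `&` _).
  apply: eq_bigcapr => i /= iJ; case: ifPn => // /eqP iE.
  by move: iJ; rewrite iE (negbTE nJ').
have U1E : U n.+1 @^-1` [set k.+1] =
    \bigcap_(i in [set` [fset n.+1]%fset]) (U i @^-1` B' i).
  by rewrite set_fset1 bigcap_set1 /B' eqxx.
have kn : (k.+1 < n.+2)%N by rewrite ltnS.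
rewrite J'E IH//; last first.
  move=> i; rewrite !inE => /orP[/eqP ->|/nJ]; first exact: ltn_ord.
  exact: leq_trans (ltnW kn).
rewrite [in RHS]U1E IH//; last first.
  by move=> i; rewrite inE => /eqP ->; exact: ltn_ord.
rewrite -muleA; congr (_ * _)%E.
rewrite -U1E U_indep; last 2 first.
- by move=> i /=; rewrite !inE => /orP[/eqP ->//|/nJ]; exact: leq_trans.
- by [].
rewrite big_fsetU1//= {1}/B' eqxx; congr (_ * _)%E.
rewrite U_indep//; last by move=> i /= /nJ; exact: leq_trans.
apply: eq_big_seq => i iJ; rewrite /B'; case: ifPn => // /eqP iE.
by move: iJ; rewrite iE (negbTE nJ').
Qed.

(** The probability that position i, counted from 0, is a record of a uniformly
    random permutation: T_(n+1) has the law of the number of records among n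
    positions. *)
Definition record_proba (i : nat) : R := i.+1%:R^-1.

Lemma clock_average n (A : set nat) : (1 <= n)%N ->
  P (T n.+1 @^-1` A) =
  (n%:R^-1 * \sum_(k < n) fine (P (T k.+1 @^-1` (S @^-1` A))))%:E.
Proof.
move=> n1; rewrite -[T n.+1 @^-1` A]setIT clock_decomposition//.
rewrite mulr_sumr -sumEFin; apply: eq_bigr => k _; rewrite setIT.
pose B (i : nat) : set nat := [set k.+1].
have UE : U n @^-1` [set k.+1] =
    \bigcap_(i in [set` [fset n]%fset]) (U i @^-1` B i).
  by rewrite set_fset1 bigcap_set1.
rewrite UE clock_indep//; last by move=> i; rewrite inE => /eqP ->; exact: ltn_ord.
rewrite -UE U_unif// ltn_ord/= muleC EFinM fineK// fin_num_measure//.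
Qed.

(** For n >= 1, n times the average over T_1, ..., T_n is the sum that the
    average over T_1, ..., T_(n+1) extends by one term, which is the recursion
    of Bernoulli sums with parameter 1 / (n+1). *)
Lemma clock_law n (A : set nat) :
  P (T n.+1 @^-1` A) = (bernoulli_sum_mean record_proba n \1_A)%:E.
Proof.
elim: n A => [|n IH] A /=.
  have [T1 _] := T_clock.
  rewrite indicE; have [A0|A0] := pselect (A 0%N).
    rewrite mem_set//= -(probability_setT P).
    by apply: measure_ae_eq => //; apply: filterS T1 => w /= ->.
  rewrite memNset//=; transitivity (P set0); last by rewrite measure0.
  by apply: measure_ae_eq => //; apply: filterS T1 => w /= ->.
have -> : \1_A \o S = \1_(S @^-1` A) :> (nat -> R).
  by apply/funext => k; rewrite /= !indicE; congr ((nat_of_bool _)%:R);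
    apply/idP/idP; rewrite !inE.
rewrite clock_average// big_ord_recr/= IH/=; congr (_%:E).
rewrite /record_proba mulrDr; congr (_ + _).
case: n IH => [|n] IH; first by rewrite big_ord0 invr1 subrr !mul0r mulr0.
rewrite -[X in _ = _ * X](EFin_inj (etrans (esym (clock_average A (ltn0Sn n))) (IH A))).
by rewrite mulrA; congr (_ * _); field; rewrite !gt_eqF ?ltr_wpDr.
Qed.

Lemma clock_le_ae n : {ae P, forall w, (T n.+1 w <= n)%N}.
Proof.
exists (T n.+1 @^-1` [set k | (n < k)%N]); split=> //.
  rewrite clock_law (@eq_bernoulli_sum_mean_le _ _ _ _ (cst 0)).
    by rewrite bernoulli_sum_mean_cst.
  by move=> k kn; rewrite indicE memNset//= ltnNge kn.
by move=> w /= /negP; rewrite -ltnNge.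
Qed.

(** T_(n+1) is at most n almost surely, so the expectation is a finite sum over
    its values, on which [clock_law] applies. *)
Lemma clock_expectation n (g : nat -> R) :
  ('E_P[g \o T n.+1])%E = (bernoulli_sum_mean record_proba n g)%:E.
Proof.
rewrite unlock.
pose h (k : 'I_n.+1) (w : Omega) : \bar R :=
  ((g k)%:E * (\1_(T n.+1 @^-1` [set val k]) w)%:E)%E.
have hi k : P.-integrable setT (h k).
  by apply: integrableZl => //; exact: integrable_indic.
have hm : measurable_fun setT (fun w => \sum_(k < n.+1) h k w)%E.
  by apply: emeasurable_sum => k; exact: measurable_int (hi k).
rewrite (ae_eq_integral (fun w => \sum_(k < n.+1) h k w)%E)//; last 2 first.
- apply/measurable_EFinP => _ Y mY; rewrite setTI.
  by rewrite (_ : _ @^-1` _ = T n.+1 @^-1` (g @^-1` Y)).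
- apply: filterS (clock_le_ae n) => w Tn _ /=.
  rewrite (bigD1 (Ordinal (Tn : (T n.+1 w < n.+1)%N)))//= big1 ?adde0.
    by rewrite /h/= indicE mem_set// mule1.
  move=> k kT; rewrite /h indicE memNset ?mule0//= => Tk.
  by move/negP : kT; apply; apply/eqP/val_inj => /=.
rewrite integral_sum//.
have hE k : (\int[P]_w h k w =
    (g k * bernoulli_sum_mean record_proba n \1_[set val k])%:E)%E.
  rewrite integralZl//; last exact: integrable_indic.
  by rewrite integral_indic// setIT EFinM -clock_law.
under eq_bigr do rewrite hE.
rewrite sumEFin; congr (_%:E).
rewrite -(bernoulli_sum_mean_sum _ _ (fun k : 'I_n.+1 => g k) (fun k => \1_[set val k])).
apply: eq_bernoulli_sum_mean_le => k kn.
rewrite (bigD1 (Ordinal (kn : (k < n.+1)%N)))//= big1 ?addr0.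
  by rewrite indicE mem_set// mulr1.
move=> j jk; rewrite indicE memNset ?mulr0//= => kj.
by move/negP : jk; apply; apply/eqP/val_inj => /=.
Qed.

End clock.

(** * Asymptotic normality of the clock *)

Lemma record_proba01 (R : realType) i : 0 <= record_proba R i <= 1.
Proof. by rewrite invr_ge0 ler0n/= invf_le1 ?ltr0n// ler1n. Qed.

(** The parameters p after the first are at most 1/2, so that
    p (1 - p) >= p / 2; the first one, 1, contributes no variance. *)
Lemma record_variance_ge (R : realType) n :
  (series harmonic n - 1) / 2 <= bernoulli_variance (record_proba R) n.
Proof.
case: n => [|n].
  by rewrite /series/= big_geq// /bernoulli_variance big_ord0; lra.
rewrite /series/= big_mkord big_ord_recl /harmonic invr1 addrAC subrr add0r.
rewrite /bernoulli_variance big_ord_recl {1 2}/record_proba invr1 subrr mulr0 add0r.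
rewrite mulr_suml; apply: ler_sum => i _; rewrite /record_proba ler_wpM2l ?invr_ge0//.
rewrite lerBrDr -lerBrDl (_ : 1 - 2^-1 = 2^-1); last by field.
by rewrite lef_pV2 ?posrE// ler_nat.
Qed.

Lemma record_variance_cvgy (R : realType) :
  bernoulli_variance (record_proba R) n @[n --> \oo] --> +oo.
Proof.
have harmonic_nd : nondecreasing_seq (series (@harmonic R)).
  by apply/nondecreasing_series => n _ _; exact: harmonic_ge0.
have harmonic_y : series (@harmonic R) n @[n --> \oo] --> +oo.
  exact: nondecreasing_dvgn_lt (@dvg_harmonic R).
apply/cvgryPge => A; near=> n.
rewrite (le_trans _ (record_variance_ge R n))// ler_pdivlMr// lerBrDr.
by near: n; move/cvgryPge : harmonic_y; apply.
Unshelve. all: by end_near. Qed.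

Theorem theorem1 (R : realType) (d : measure_display) (Omega : measurableType d)
    (P : probability Omega R) (U T : nat -> {RV P >-> nat})
    (U_indep : mutually_independent [set n : nat | (1 <= n)%N] U)
    (U_unif : forall n : nat, (1 <= n)%N -> uniform_upto n (U n))
    (T_clock : reverting_clock U T) :
  let X (n : nat) (w : Omega) : R := (T n w)%:R in
  let m (n : nat) : R := fine ('E_P[X n])%E in
  let v (n : nat) : R := fine ('V_P[X n])%E in
  forall x : R,
    P [set w | (X n w - m n) / Num.sqrt (v n) <= x] @[n --> \oo]
      --> std_normal_cdf x.
Proof.
move=> X m v x.
pose p := record_proba R; have p01 := record_proba01 R.
have ET := clock_expectation U_indep U_unif T_clock.
have mE n : m n.+1 = \sum_(i < n) p i.
  by rewrite /m (ET n (fun k => k%:R))/= bernoulli_sum_mean_id.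
have vE n : v n.+1 = bernoulli_variance p n.
  rewrite /v /variance covariance.unlock -/(m n.+1) mE.
  rewrite (_ : _ * _ = (fun k => (k%:R - \sum_(i < n) p i) ^+ 2) \o T n.+1)//.
  by rewrite ET/= bernoulli_sum_mean_var.
(* T 0 is arbitrary, hence the shift by one. *)
rewrite -cvg_shiftS std_normal_cdfE.
rewrite (_ : (fun n => _) = (fun n => (bernoulli_sum_mean p n
    (fun k => (standardized p n k <= x)%R%:R))%:E)); last first.
  apply/funext => n; rewrite mE vE.
  rewrite (_ : [set _ | _] = T n.+1 @^-1` [set k | standardized p n k <= x])//.
  rewrite (clock_law U_indep U_unif T_clock); congr (_%:E).
  apply: eq_bernoulli_sum_mean => k; rewrite indicE; congr ((nat_of_bool _)%:R).
  by apply/idP/idP; rewrite inE.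
apply: cvg_EFin; first by near=> n.
exact: (bernoulli_sum_clt p01 (@record_variance_cvgy R)).
Unshelve. all: by end_near. Qed.
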